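(* Let $a,b\in L^\infty$ satisfy the standing assumption on symbol pairs. Then: (i) $\ker\Sigma_{a,b}\cap H^2_+=\ker T_a\cap\ker H_b$; (ii) $\ker\Sigma_{a,b}\cap H^2_-=\ker\widetilde H_a\cap\ker\widetilde T_b$.
   Context: $\mathbb T$ is the unit circle, $L^2=L^2(\mathbb T)$, $L^\infty=L^\infty(\mathbb T)$; $H^2_+=H^2(\mathbb D)$ is the Hardy space regarded as a closed subspace of $L^2$ via boundary values, $H^2_-=(H^2_+)^\perp$ in $L^2$, and $P^\pm$ are the orthogonal projections of $L^2$ onto $H^2_\pm$. For $a,b\in L^\infty$, $\Sigma_{a,b}f=P^+(af)+P^-(bf)$ for $f\in L^2$. For $g\in L^\infty$: $T_g:H^2_+\to H^2_+$, $T_gf=P^+(gf)$; $\widetilde T_g:H^2_-\to H^2_-$, $\widetilde T_gf=P^-(gf)$; $H_g:H^2_+\to H^2_-$, $H_gf=P^-(gf)$; $\widetilde H_g:H^2_-\to H^2_+$, $\widetilde H_gf=P^+(gf)$. Standing assumption on a symbol pair $(a,b)$: $a\neq0$ a.e. and $b\neq 0$ a.e. on $\mathbb T$, and either $a=b$ or $a-b\neq0$ a.e. on $\mathbb T$. *)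

(* Defs.v *)
From HB Require Import structures.
From mathcomp Require Import all_boot all_order all_algebra.
From mathcomp Require Export complex.
From mathcomp Require Export all_classical all_reals all_analysis.
From mathcomp Require Import measurable_realfun.

Set Implicit Arguments.
Unset Strict Implicit.
Unset Printing Implicit Defensive.

Import Order.TTheory GRing.Theory Num.Theory.
Import ComplexField.Normc.
Import numFieldNormedType.Exports.

Local Open Scope classical_set_scope.
Local Open Scope complex_scope.
Local Open Scope ring_scope.

Definition circle (R : realType) : Type := {z : R[i] | normc z == 1}.

Section circle.
Variable R : realType.

Fact normc_expi (t : R) : normc (cos t +i* sin t) == 1.
Proof. by rewrite /= cos2Dsin2 sqrtr1. Qed.

Definition expi (t : measurableTypeR R) : circle R :=
  Sub (cos t +i* sin t) (normc_expi t).

HB.instance Definition _ := Choice.on (circle R).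
HB.instance Definition _ := isPointed.Build (circle R) (expi 0).

Definition circle_coord (z : circle R) : measurableTypeR R * measurableTypeR R :=
  (complex.Re (val z), complex.Im (val z)).

(* Borel sigma-algebra of the circle, as a subspace of R^2. *)
HB.instance Definition _ :=
  Measurable.copy (circle R) (g_sigma_algebra_preimageType circle_coord).

Fact measurable_expi : measurable_fun [set: measurableTypeR R] expi.
Proof.
move=> _ A [B mB] <-; rewrite !setTI -comp_preimage.
have -> : circle_coord \o expi =
    (fun t => (cos t, sin t) : measurableTypeR R * measurableTypeR R) by [].
rewrite -[X in measurable X]setTI.
apply: measurable_fun_pair => //.
  by apply: continuous_measurable_fun; exact: continuous_cos.
by apply: continuous_measurable_fun; exact: continuous_sin.
Qed.

HB.instance Definition _ :=
  isMeasurableFun.Build _ _ (measurableTypeR R) (circle R) expi measurable_expi.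

Fact pi2_gt0 : 0 < pi *+ 2 :> R.
Proof. by rewrite mulrn_wgt0 ?pi_gt0. Qed.

(* Normalized arc length, i.e. dt / (2 pi) transported by t |-> e^(it). *)
Definition arc : probability (circle R) R :=
  distribution (uniform_prob pi2_gt0) (expi : {mfun measurableTypeR R >-> circle R}).

End circle.

Arguments arc {R}.

Section function_spaces.
Variable R : realType.
Local Notation C := R[i].
Local Notation L0 := (circle R -> C).
Implicit Types (p : \bar R) (f g h : L0).

(* Elements of L^p are represented by functions; two functions represent the
   same element when they agree almost everywhere for arc. *)
Definition Lp p : set L0 :=
  [set f : L0 | [/\ measurable_fun [set: circle R] (fun z => complex.Re (f z)),
              measurable_fun [set: circle R] (fun z => complex.Im (f z)) &
              finite_norm arc p (fun z => normc (f z))]].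

Definition L2 : set L0 := Lp 2%:E.
Definition Linfty : set L0 := Lp +oo%E.

Definition inner f g : C :=
  let fg z := f z * (g z)^* in
  Rintegral arc setT (fun z => complex.Re (fg z)) +i*
  Rintegral arc setT (fun z => complex.Im (fg z)).

Definition orthocompl (H : set L0) : set L0 :=
  [set g : L0 | L2 g /\ forall h, H h -> inner g h = 0].

(* For a closed subspace H of L^2 and f in L^2, the set below is one class of
   functions equal almost everywhere, and the choice depends only on the class
   of f; the default value 0 is then not used. *)
Definition orthoproj (H : set L0) f : L0 :=
  xget (cst 0) [set g : L0 | H g /\ forall h, H h -> inner (f - g) h = 0].

Definition holomorphic_on_disk (F : C -> C) :=
  forall z : C, normc z < 1 -> derivable (F : C^o -> C^o) z 1.

Definition dilate (F : C -> C) (r : R) : L0 := fun z => F (r%:C * val z).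

(* The Hardy space of the disk; F is irrelevant outside of the disk. *)
Definition hardy2 : set (C -> C) :=
  [set F | holomorphic_on_disk F /\
    exists M : R, forall r : R, 0 <= r < 1 ->
      (\int[arc]_z ((normc (dilate F r z)) ^+ 2)%:E <= M%:E)%E].

(* Radial limits almost everywhere. *)
Definition is_boundary_value (F : C -> C) f :=
  \forall z \ae arc, (dilate F r z : C^o) @[r --> (1 : R)^'-] --> (f z : C^o).

Definition H2p : set L0 :=
  [set f : L0 | L2 f /\ exists2 F, hardy2 F & is_boundary_value F f].
Definition H2m : set L0 := orthocompl H2p.

Definition Pp : L0 -> L0 := orthoproj H2p.
Definition Pm : L0 -> L0 := orthoproj H2m.

Definition ker (A B : set L0) (T : {fun A >-> B}) : set L0 :=
  [set f : L0 | A f /\ T f = 0 %[ae arc]].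

Lemma L2_0 : L2 (cst 0).
Proof.
split; [exact: measurable_cst|exact: measurable_cst|].
rewrite /finite_norm (_ : _ \o _ = cst 0%E).
  by rewrite Lnorm0 ?ltry// gt_eqF// lte_fin.
by apply/funext => z /=; rewrite expr0n /= addr0 sqrtr0.
Qed.

Lemma measurable_normc f :
    measurable_fun [set: circle R] (fun z => complex.Re (f z)) ->
    measurable_fun [set: circle R] (fun z => complex.Im (f z)) ->
  measurable_fun [set: circle R] (fun z => normc (f z)).
Proof.
move=> mRe mIm; rewrite (_ : (fun z => normc (f z)) = Num.sqrt \o (fun z =>
    (complex.Re (f z)) ^+ 2 + (complex.Im (f z)) ^+ 2)); last first.
  by apply/funext => z /=; case: (f z).
apply: measurableT_comp; last by apply: measurable_funD; exact: measurable_funX.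
by apply: continuous_measurable_fun; exact: sqrt_continuous.
Qed.

Lemma L2D f g : L2 f -> L2 g -> L2 (f + g).
Proof.
move=> [mfr mfi nf] [mgr mgi ng].
have mr : measurable_fun [set: circle R] (fun z => complex.Re ((f + g) z)).
  rewrite (_ : (fun z => _) = (fun z => complex.Re (f z) + complex.Re (g z))).
    exact: measurable_funD.
  by apply/funext => z /=; rewrite !fctE; case: (f z) (g z) => ? ? [].
have mi : measurable_fun [set: circle R] (fun z => complex.Im ((f + g) z)).
  rewrite (_ : (fun z => _) = (fun z => complex.Im (f z) + complex.Im (g z))).
    exact: measurable_funD.
  by apply/funext => z /=; rewrite !fctE; case: (f z) (g z) => ? ? [].
split => //; rewrite /finite_norm.
have mnf := measurable_normc mfr mfi; have mng := measurable_normc mgr mgi.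
have mnfg := measurable_normc mr mi.
have n0 (x : R[i]) : 0 <= normc x by case: x => ? ?; exact: sqrtr_ge0.
pose nfg : circle R -> R := (fun z => normc (f z)) \+ (fun z => normc (g z)).
apply: (@le_lt_trans _ _ ('N[@arc R]_2%:E[EFin \o nfg])%E); last first.
  apply: (le_lt_trans (eminkowski _ mnf mng _)); first by rewrite lee_fin ler1n.
  by rewrite lte_add_pinfty.
rewrite unlock gt0_ler_poweR//.
- by rewrite in_itv/= leey integral_ge0.
- by rewrite in_itv/= leey integral_ge0.
rewrite ge0_le_integral//.
- by move=> z _; exact: poweR_ge0.
- apply/measurable_EFinP.
  apply/(@measurableT_comp _ _ _ _ _ _ (fun x : R => x `^ 2)%R) => //.
  exact/measurableT_comp.
- apply/measurable_EFinP.
  apply/(@measurableT_comp _ _ _ _ _ _ (fun x : R => x `^ 2)%R) => //.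
  by apply/measurableT_comp => //; exact: measurable_funD.
move=> z _ /=; rewrite lee_fin ge0_ler_powR ?nnegrE//.
rewrite !ger0_norm ?addr_ge0//; exact: (@le_normcD R).
Qed.

Lemma H2m_0 : H2m (cst 0).
Proof.
split; first exact: L2_0.
move=> h _; rewrite /inner /=.
under eq_Rintegral do rewrite mul0r.
under [X in _ +i* X]eq_Rintegral do rewrite mul0r.
by rewrite !Rintegral_cst //= !mul0r.
Qed.

Lemma H2p_0 : H2p (cst 0).
Proof.
split; first exact: L2_0.
exists (cst 0); last by apply: nearW => z; exact: cvg_cst.
split; first by move=> z _; exact: derivable_cst.
exists 0 => r _; under eq_integral do
  rewrite /dilate /= expr0n /= addr0 sqrtr0 expr0n /=.
by rewrite integral0.
Qed.

Lemma PpP f : H2p (Pp f).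
Proof. by rewrite /Pp /orthoproj; case: xgetP => [g _ []|_] //; exact: H2p_0. Qed.

Lemma PmP f : H2m (Pm f).
Proof. by rewrite /Pm /orthoproj; case: xgetP => [g _ []|_] //; exact: H2m_0. Qed.

Lemma Sigma_subproof (a b : L0) :
  set_fun L2 L2 (fun f => Pp (a \* f) + Pm (b \* f)).
Proof. by move=> f _; apply: L2D; [case: (PpP (a \* f))|case: (PmP (b \* f))]. Qed.

Definition Sigma (a b : L0) : {fun L2 >-> L2} := mkfun_fun (@Sigma_subproof a b).

Definition toeplitz (g : L0) : {fun H2p >-> H2p} :=
  mkfun_fun (fun f (_ : H2p f) => PpP (g \* f)).

Definition dual_toeplitz (g : L0) : {fun H2m >-> H2m} :=
  mkfun_fun (fun f (_ : H2m f) => PmP (g \* f)).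

Definition hankel (g : L0) : {fun H2p >-> H2m} :=
  mkfun_fun (fun f (_ : H2p f) => PmP (g \* f)).

Definition dual_hankel (g : L0) : {fun H2m >-> H2p} :=
  mkfun_fun (fun f (_ : H2m f) => PpP (g \* f)).

(* Standing assumption on symbol pairs; a and b are elements of L^oo, so that
   a = b is meant almost everywhere. *)
Definition symbol_pair (a b : L0) :=
  [/\ \forall z \ae arc, a z != 0, \forall z \ae arc, b z != 0 &
      a = b %[ae arc] \/ \forall z \ae arc, a z - b z != 0].

End function_spaces.

(* Main.v *)
(** Since P^+(af) lies in H^2_+ and P^-(bf) in its orthogonal complement, their
    sum Sigma_{a,b} f vanishes a.e. if and only if both of them do: from
    u + v = 0 and <v, u> = 0 one gets <u, u> = 0. *)
Require Import Defs.
From mathcomp Require Import all_boot all_order all_algebra.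
From mathcomp Require Import complex.
From mathcomp Require Import all_classical all_reals all_analysis.
From mathcomp Require Import measurable_realfun.

Import GRing.Theory Num.Theory.

Local Open Scope classical_set_scope.
Local Open Scope ring_scope.

Section orthogonality.
Set Implicit Arguments.
Unset Strict Implicit.
Variable R : realType.
Implicit Types f u v : circle R -> R[i].

(** The real part of [w * z^*], that is, the Euclidean inner product of the plane. *)
Definition dotc (w z : R[i]) : R :=
  complex.Re w * complex.Re z + complex.Im w * complex.Im z.

Lemma dotcNl (w z : R[i]) : dotc (- w) z = - dotc w z.
Proof. by case: w z => ? ? [? ?]; rewrite /dotc /= !mulNr opprD. Qed.

Lemma dotc_normc (z : R[i]) : dotc z z = ComplexField.Normc.normc z ^+ 2.
Proof.
by case: z => x y; rewrite /dotc /= sqr_sqrtr -?expr2 // addr_ge0 // sqr_ge0.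
Qed.

Lemma dotc_ge0 (z : R[i]) : 0 <= dotc z z.
Proof. by rewrite dotc_normc sqr_ge0. Qed.

Lemma dotc_eq0 (z : R[i]) : dotc z z = 0 -> z = 0.
Proof.
rewrite dotc_normc => /eqP; rewrite sqrf_eq0 => /eqP.
exact: ComplexField.Normc.eq0_normc.
Qed.

(** Taking real parts turns orthogonality into one real integral, whose integrand is nonnegative
    when [u] and [v] coincide. *)
Lemma Re_inner u v :
  complex.Re (inner u v) = Rintegral Defs.arc setT (fun z => dotc (u z) (v z)).
Proof.
rewrite /inner /=; apply: eq_Rintegral => z _.
by rewrite /dotc; case: (u z) (v z) => ? ? [? ?] /=; rewrite mulrN opprK.
Qed.

Lemma measurable_dotc u v : L2 u -> L2 v ->
  measurable_fun setT (fun z => dotc (u z) (v z)).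
Proof.
by move=> [ur ui _] [vr vi _]; apply: measurable_funD; exact: measurable_funM.
Qed.

(** The integral is the square of the norm of [u] in [L2]. *)
Lemma L2_dotc_lty u : L2 u -> (\int[Defs.arc]_z (dotc (u z) (u z))%:E < +oo)%E.
Proof.
move=> [_ _]; rewrite /finite_norm => /(poweR_lty 2).
rewrite poweR_Lnorm// (_ : (\int[_]_x _)%E = (\int[Defs.arc]_z (dotc (u z) (u z))%:E)%E)//.
apply: eq_integral => z _ /=.
by rewrite powR_mulrn// real_normK ?num_real// dotc_normc.
Qed.

Lemma orthogonal_sum_eq0 u v : L2 u -> L2 v -> inner v u = 0 ->
  u + v = 0 %[ae Defs.arc] -> u = 0 %[ae Defs.arc] /\ v = 0 %[ae Defs.arc].
Proof.
move=> Lu Lv vu0 uv0.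
suff u0 : u = 0 %[ae Defs.arc].
  split=> //; apply: filterS2 u0 uv0 => z u0 uv0 _.
  by move: (uv0 I); rewrite !fctE u0// add0r.
have muu := measurable_dotc Lu Lu; have mvu := measurable_dotc Lv Lu.
have : Rintegral Defs.arc setT (fun z => dotc (v z) (u z)) = 0.
  by rewrite -Re_inner vu0.
(* Almost everywhere [v = - u], so orthogonality becomes a statement about the integral of
   [- dotc (u z) (u z)]. *)
rewrite /Rintegral (@ae_eq_integral _ _ _ _ _ (fun z => (- dotc (u z) (u z))%:E))//;
  first last.
- apply: filterS uv0 => z uv0 _; move: (uv0 I); rewrite !fctE => /eqP.
  by rewrite addrC addr_eq0 => /eqP ->; rewrite dotcNl.
- by apply/measurable_EFinP; exact: measurableT_comp.
- exact/measurable_EFinP.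
under eq_integral do rewrite EFinN.
rewrite integral_ge0N; last by move=> z _; rewrite lee_fin dotc_ge0.
rewrite fineN => /eqP; rewrite oppr_eq0 => /eqP int0.
(* [fine] also sends [+oo] to 0, so [int0] alone does not make the integral zero; finiteness, from
   [u] in [L2], closes the gap. *)
have fin : (\int[Defs.arc]_z (dotc (u z) (u z))%:E)%E \is a fin_num.
  rewrite ge0_fin_numE ?L2_dotc_lty//.
  by apply: integral_ge0 => z _; rewrite lee_fin dotc_ge0.
have {int0} : (\int[Defs.arc]_z `|(dotc (u z) (u z))%:E| = 0)%E.
  under eq_integral do rewrite gee0_abs ?lee_fin ?dotc_ge0//.
  by rewrite -(fineK fin) int0.
have muuE : measurable_fun setT (fun z => (dotc (u z) (u z))%:E).
  exact/measurable_EFinP.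
move/(ae_eq_integral_abs Defs.arc measurableT muuE).
by apply: filterS => z /(_ I) [] /dotc_eq0.
Qed.

Lemma H2p_H2m_sum_eq0 u v : H2p u -> H2m v ->
  u + v = 0 %[ae Defs.arc] <-> u = 0 %[ae Defs.arc] /\ v = 0 %[ae Defs.arc].
Proof.
move=> Hu [Lv vH]; split=> [|[u0 v0]].
  by case: (Hu) => Lu _; apply: orthogonal_sum_eq0 => //; exact: vH.
by apply: filterS2 u0 v0 => z u0 v0 _; rewrite !fctE u0// v0// addr0.
Qed.

(** [PpP] and [PmP] place the two summands in [H2p] and [H2m] for every [f], even where [orthoproj]
    takes its default value 0, so the orthogonality argument always applies. *)
Lemma ker_SigmaE (a b : circle R -> R[i]) f : ker (Sigma a b) f <->
  [/\ L2 f, Pp (a \* f) = 0 %[ae Defs.arc] & Pm (b \* f) = 0 %[ae Defs.arc]].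
Proof.
have E := H2p_H2m_sum_eq0 (PpP (a \* f)) (PmP (b \* f)).
split=> [[Lf /E[]]//|[Lf p0 m0]]; split=> //.
exact/E.
Qed.

End orthogonality.

Theorem proposition4p4 (R : realType) (a b : circle R -> R[i])
    (La : Linfty a) (Lb : Linfty b) (ab : symbol_pair a b) :
  ker (Sigma a b) `&` @H2p R = ker (toeplitz a) `&` ker (hankel b) /\
  ker (Sigma a b) `&` @H2m R = ker (dual_hankel a) `&` ker (dual_toeplitz b).
Proof.
split; apply/seteqP; split=> f.
(* The Toeplitz and Hankel operators are [Pp (a \* f)] and [Pm (b \* f)] restricted to [H2p] or
   [H2m], so their kernel conditions are [p0] and [m0] by conversion. In the converse inclusions,
   [case: Hf] supplies [L2 f]. *)
- by move=> [/ker_SigmaE[_ p0 m0] Hf].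
- by move=> [[Hf p0] [_ m0]]; split=> //; apply/ker_SigmaE; split=> //; case: Hf.
- by move=> [/ker_SigmaE[_ p0 m0] Hf].
- by move=> [[Hf p0] [_ m0]]; split=> //; apply/ker_SigmaE; split=> //; case: Hf.
Qed.
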